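(* The set of real numbers $\alpha$ for which there exists a constant length random substitution $\vartheta$ (over some finite alphabet) whose subshift $X_\vartheta$ has complexity function $p_{X_\vartheta}(n)=\Theta(n^\alpha)$ is dense in $[1,\infty)$.
   Context: Let $\mathcal{A}$ be a finite alphabet, $\mathcal{A}^+$ the set of non-empty finite words over $\mathcal{A}$. A random substitution over $\mathcal{A}$ is a map $\vartheta$ assigning to each letter $a\in\mathcal{A}$ a non-empty finite set $\vartheta(a)\subset\mathcal{A}^+$ of realisations (together with a choice of strictly positive probabilities on each $\vartheta(a)$, which plays no role here and is ignored). It is of constant length if there is an integer $\ell\ge 2$ such that $|v|=\ell$ for all $a\in\mathcal{A}$ and $v\in\vartheta(a)$. For a word $u=u_1\cdots u_n$, $\vartheta(u)=\{w_1\cdots w_n : w_i\in\vartheta(u_i)\}$; powers are defined by $\vartheta^1=\vartheta$ and $\vartheta^k(a)=\bigcup_{v\in\vartheta^{k-1}(a)}\vartheta(v)$. A word is $\vartheta$-legal if it is a (contiguous) subword of some word in $\vartheta^k(a)$ for some $k\in\mathbb{N}$, $a\in\mathcal{A}$; $\mathcal{L}_\vartheta$ is the set of legal words. The subshift of $\vartheta$ is $X_\vartheta=\{w\in\mathcal{A}^{\mathbb{Z}} : \text{every finite subword of } w \text{ lies in } \mathcal{L}_\vartheta\}$ with the left shift. No primitivity is assumed. The complexity function $p_X(n)$ is the number of distinct words of length $n$ occurring in elements of $X$. For positive functions $f,g$ on $\mathbb{N}$, $g=\Theta(f)$ means there exist $C_1,C_2>0$ with $C_1<f(n)/g(n)<C_2$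 for all $n\in\mathbb{N}$. A set of real numbers is called dense in $[1,\infty)$ if its intersection with $[1,\infty)$ is a dense subset of $[1,\infty)$. *)

(* Defs.v *)
From mathcomp Require Import all_boot all_order all_algebra.
From mathcomp Require Import all_classical all_reals all_analysis.

Set Implicit Arguments.
Unset Strict Implicit.
Unset Printing Implicit Defensive.

Import Order.TTheory GRing.Theory Num.Theory.
Import numFieldNormedType.Exports.

Local Open Scope classical_set_scope.
Local Open Scope ring_scope.

(* Only the sets of realisations are recorded: the (strictly positive)
   probabilities attached to them influence neither the language nor the
   subshift. *)
Record random_substitution (A : finType) := RandomSubstitution {
  realisations :> A -> set (seq A);
  realisations_finite : forall a, finite_set (realisations a);
  realisations_nonempty : forall a, realisations a !=set0;
  realisations_neq_nil : forall a v, realisations a v -> v <> [::] }.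

Definition constant_length (A : finType) (theta : random_substitution A) :=
  exists l : nat, (2 <= l)%N /\ forall a v, theta a v -> size v = l.

Fixpoint subst_word (A : finType) (theta : random_substitution A)
    (u : seq A) : set (seq A) :=
  if u is a :: u' then [set v ++ w | v in theta a & w in subst_word theta u']
  else [set [::]].

(* The value at k = 0 is only a seed for the recursion; [subst_pow1] below
   checks that the first power is theta itself. *)
Fixpoint subst_pow (A : finType) (theta : random_substitution A)
    (k : nat) (a : A) : set (seq A) :=
  if k is k'.+1 then \bigcup_(v in subst_pow theta k' a) subst_word theta v
  else [set [:: a]].

Lemma subst_pow1 (A : finType) (theta : random_substitution A) (a : A) :
  subst_pow theta 1 a = theta a.
Proof.
rewrite /= bigcup_set1 /=; apply/seteqP; split=> [w [v tv [_ ->]] <-|w tw].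
  by rewrite cats0.
by exists w => //; exists [::]; rewrite ?cats0.
Qed.

(* Powers start at k = 1, so a letter is legal only if it occurs in some
   realisation. *)
Definition legal (A : finType) (theta : random_substitution A) : set (seq A) :=
  [set u | exists k a v, [/\ (0 < k)%N, subst_pow theta k a v & infix u v]].

Definition factor (A : finType) (w : int -> A) (i : int) (n : nat) : n.-tuple A :=
  [tuple w (i + (j : nat)%:Z) | j < n].

Definition subshift (A : finType) (theta : random_substitution A) :
    set (int -> A) :=
  [set w | forall i n, legal theta (factor w i n)].

Definition complexity (A : finType) (X : set (int -> A)) (n : nat) : nat :=
  #|[pred u : n.-tuple A | `[< exists2 w, X w & exists i, u = factor w i n >]]|.

(* g = Theta(f), for positive functions on the positive integers: n = 0 is
   excluded since n ^ alpha vanishes there. *)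
Definition isTheta (R : realType) (f g : nat -> R) :=
  (forall n, (0 < n)%N -> 0 < f n /\ 0 < g n) /\
  exists C1 C2 : R, [/\ 0 < C1, 0 < C2 &
    forall n, (0 < n)%N -> C1 < f n / g n < C2].

Definition dense_in (T : topologicalType) (Y S : set T) :=
  Y `<=` closure (S `&` Y).

(* Main.v *)
(* Take letters d (seed), a (pivot) and b_0, ..., b_(M-1) (digits), length l, and
     d -> b_0^(l-1) a,   a -> a b_i^(l-1) for an arbitrary i,   b_i -> b_i^l.
   The legal words are the finite windows of the sequences
     ... b_0 b_0 b_0 a b_(f 0) ... b_(f k) ...,
   where b_(f k) fills the positions t with l^k <= t < l^(k+1) and f is arbitrary.
   A window of length n is given by its position, for which about n choices
   matter, and by about log_l n free values of f, so that the complexity is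
   of order n * M^(log_l n) = n^(1 + log_l M). With l = 2^q and M = 2^p the
   exponent is 1 + p/q. *)

Require Import Defs.
From mathcomp Require Import all_boot all_order all_algebra.
From mathcomp Require Import all_classical all_reals all_analysis.
From mathcomp Require Import zify ring lra.
Import Order.TTheory GRing.Theory Num.Theory.
Import numFieldNormedType.Exports.
Local Open Scope classical_set_scope.
Local Open Scope ring_scope.

(** * Images of concatenations; windows of sequences *)

Lemma subst_word_cat (A : finType) (theta : random_substitution A)
    (u v : seq A) :
  subst_word theta (u ++ v) =
  [set x ++ y | x in subst_word theta u & y in subst_word theta v].
Proof.
elim: u => [|a u IH] /=.
  apply/seteqP; split=> [w vw|_ [_ -> [w vw <-]]] //.
  by exists [::] => //; exists w.
rewrite IH; apply/seteqP; split.
- move=> _ [p tp [_ [x ux [y vy <-]] <-]].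
  exists (p ++ x); first by exists p => //; exists x.
  by exists y; rewrite ?catA.
- move=> _ [_ [p tp [x ux <-]] [y vy <-]].
  exists p => //; exists (x ++ y); last by rewrite catA.
  by exists x => //; exists y.
Qed.

Lemma subst_word_nseq (A : finType) (theta : random_substitution A)
    (a : A) (w : seq A) (n : nat) :
  theta a = [set w] ->
  subst_word theta (nseq n a) = [set flatten (nseq n w)].
Proof.
move=> ta; elim: n => [|n IH] //=; rewrite IH ta.
apply/seteqP; split=> [_ [_ -> [_ -> <-]] //|_ ->].
by exists w => //; exists (flatten (nseq n w)).
Qed.

Lemma infix_mkseq (T : eqType) (g : nat -> T) (s n N : nat) :
  (s + n <= N)%N -> infix (mkseq (fun t => g (s + t)%N) n) (mkseq g N).
Proof.
move=> le_sn; apply/infixP.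
exists (mkseq g s), (map g (iota (s + n) (N - (s + n)))).
rewrite /mkseq -[in LHS](subnKC le_sn) -addnA !iotaD !map_cat add0n.
by rewrite -[in iota s n](addn0 s) iotaDl -map_comp.
Qed.

(** * The substitution and its pivot-centred sequences *)

Section Construction.
Variables (L m : nat).
Local Notation l := L.+1.

(** [L] and [m] are predecessors: realisations have length [l = L.+1] and there are [m.+1] digits,
    so the default digit [ord0] always exists. *)
Definition letter := option (option 'I_m.+1).
Definition seed : letter := None.
Definition pivot : letter := Some None.
Definition digit (i : 'I_m.+1) : letter := Some (Some i).

(* No rule produces [seed]; it only puts an infinite past before [pivot]. *)
Definition rules (a : letter) : set (seq letter) :=
  match a with
  | None => [set rcons (nseq L (digit ord0)) pivot]
  | Some None => range (fun i => pivot :: nseq L (digit i))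
  | Some (Some i) => [set nseq l (digit i)]
  end.

Lemma rules_finite a : finite_set (rules a).
Proof. by case: a => [[i|]|] //=; exact: finite_image. Qed.

Lemma rules_nonempty a : rules a !=set0.
Proof.
case: a => [[i|]|] /=; [by eexists| |by eexists].
by exists (pivot :: nseq L (digit ord0)); exists ord0.
Qed.

Lemma rules_size a v : rules a v -> size v = l.
Proof.
by case: a => [[i -> |[i _ <-]]| ->] //=; rewrite ?size_rcons size_nseq.
Qed.

Lemma rules_neq_nil a v : rules a v -> v <> [::].
Proof. by move=> /rules_size sv v0; rewrite v0 in sv. Qed.

Definition theta : random_substitution letter :=
  RandomSubstitution rules_finite rules_nonempty rules_neq_nil.

(** Coordinates are centred at the pivot, so that substituting multiplies them by [l] and raises the
    level [trunc_log l t] by one. *)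
Definition ray (f : nat -> 'I_m.+1) (t : int) : letter :=
  match t with
  | Posz 0 => pivot
  | Posz t'.+1 => digit (f (trunc_log l t'.+1))
  | Negz _ => digit ord0
  end.

Arguments ray : simpl never.

Definition ray_prefix (k : nat) (f : nat -> 'I_m.+1) : seq letter :=
  pivot :: flatten [seq nseq (L * l ^ j) (digit (f j)) | j <- iota 0 k].

Definition scons (i : 'I_m.+1) (f : nat -> 'I_m.+1) (k : nat) : 'I_m.+1 :=
  if k is k'.+1 then f k' else i.

(** * Powers of the substitution in closed form *)

Hypothesis L_gt0 : (0 < L)%N.

(** The block of level j has length L l^j = l^(j+1) - l^j, so consecutive blocks meet exactly where
    [trunc_log l] jumps. *)
Lemma ray_prefixE k f : ray_prefix k f = mkseq (fun t => ray f t%:Z) (l ^ k).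
Proof.
elim: k => [|k IH] //.
rewrite /ray_prefix -(addn1 k) iotaD map_cat flatten_cat -cat_cons.
rewrite -/(ray_prefix k f) IH /= cats0 add0n /mkseq.
rewrite addn1 expnS mulSn [in RHS]iotaD map_cat; congr cat.
apply: (@eq_from_nth _ pivot).
  by rewrite size_nseq size_map size_iota.
move=> i; rewrite size_nseq => ltiL.
rewrite nth_nseq ltiL (nth_map 0%N) ?size_iota // nth_iota // add0n.
have lk0 : (0 < l ^ k)%N by rewrite expn_gt0.
rewrite -(prednK (n := l ^ k + i)) ?addn_gt0 ?lk0 // /ray prednK ?addn_gt0 ?lk0 //.
by rewrite (@trunc_log_eq _ k) // leq_addr expnS mulSn ltn_add2l.
Qed.

Lemma flatten_nseq_nseq (T : Type) (n p : nat) (x : T) :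
  flatten (nseq n (nseq p x)) = nseq (n * p) x.
Proof. by elim: n => //= n ->; rewrite -nseqD mulSn. Qed.

(** Each digit block grows by the factor [l] and moves up one level; the only free choice is the
    digit emitted by the pivot, which fills level 0. *)
Lemma subst_word_ray_prefix k f :
  subst_word theta (ray_prefix k f) =
  [set ray_prefix k.+1 (scons i f) | i in setT].
Proof.
have tail j0 : subst_word theta
    (flatten [seq nseq (L * l ^ j) (digit (f j)) | j <- iota j0 k]) =
    [set flatten [seq nseq (L * l ^ j.+1) (digit (f j)) | j <- iota j0 k]].
  elim: k j0 => [|k IH] j0 //=.
  rewrite subst_word_cat IH (@subst_word_nseq _ _ _ (nseq l (digit (f j0)))) //.
  rewrite flatten_nseq_nseq -mulnA -expnSr.
  apply/seteqP; split=> [_ [_ -> [_ -> <-]] //|_ ->].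
  by eexists; first reflexivity; eexists; first reflexivity.
have E i : ray_prefix k.+1 (scons i f) = (pivot :: nseq L (digit i)) ++
    flatten [seq nseq (L * l ^ j.+1) (digit (f j)) | j <- iota 0 k].
  rewrite /ray_prefix /= expn0 muln1 -[1%N]addn0 iotaDl -map_comp.
  by congr (_ :: _ ++ flatten _); apply: eq_map.
rewrite /= tail; apply/seteqP; split.
- by move=> _ [_ [i _ <-] [_ -> <-]]; exists i; rewrite // E.
- move=> _ [i _ <-]; rewrite E; exists (pivot :: nseq L (digit i)).
    by exists i.
  by eexists; first reflexivity.
Qed.

Lemma subst_pow_digit k i :
  subst_pow theta k (digit i) = [set nseq (l ^ k) (digit i)].
Proof.
elim: k => [|k IH] //=.
rewrite IH bigcup_set1 (@subst_word_nseq _ _ _ (nseq l (digit i))) //.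
by rewrite flatten_nseq_nseq expnSr.
Qed.

Lemma subst_pow_pivot k : subst_pow theta k pivot = range (ray_prefix k).
Proof.
elim: k => [|k IH] /=.
  apply/seteqP; split=> [_ ->|_ [f _ <-]] //.
  by exists (fun=> ord0).
rewrite IH; apply/seteqP; split.
- move=> w [_ [f _ <-]]; rewrite subst_word_ray_prefix => -[i _ <-].
  by exists (scons i f).
(* The last choice made is level 0, so the preceding power carries the remaining levels, shifted
   down by one. *)
- move=> _ [f _ <-]; exists (ray_prefix k (fun j => f j.+1)).
    by exists (fun j => f j.+1).
  rewrite subst_word_ray_prefix; exists (f 0%N) => //.
  by rewrite /ray_prefix; congr (_ :: flatten _); apply: eq_map => -[].
Qed.

Lemma subst_pow_seed k : subst_pow theta k.+1 seed =
  [set nseq (L * l ^ k) (digit ord0) ++ ray_prefix k f | f in setT].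
Proof.
elim: k => [|k IH].
  rewrite subst_pow1 /=; apply/seteqP.
  split=> [_ ->|_ [f _ <-]]; last by rewrite muln1 cats1.
  by exists (fun=> ord0); rewrite // muln1 cats1.
have E f : subst_word theta (nseq (L * l ^ k) (digit ord0) ++ ray_prefix k f) =
    [set nseq (L * l ^ k.+1) (digit ord0) ++ w
      | w in subst_word theta (ray_prefix k f)].
  rewrite subst_word_cat (@subst_word_nseq _ _ _ (nseq l (digit ord0))) //.
  rewrite flatten_nseq_nseq -mulnA -expnSr.
  apply/seteqP; split=> [_ [_ -> [w tw <-]]|_ [w tw <-]]; first by exists w.
  by eexists; first reflexivity; exists w.
rewrite -[subst_pow _ _ _]/(\bigcup_(v in subst_pow theta k.+1 seed) _) IH.
apply/seteqP; split.
- move=> w [_ [f _ <-]]; rewrite E subst_word_ray_prefix.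
  by move=> -[_ [i _ <-] <-]; exists (scons i f).
- move=> _ [f _ <-].
  (* The pivot case, read backwards, supplies [g] with [ray_prefix k.+1 f] among the images of
     [ray_prefix k g]. *)
  have : range (ray_prefix k.+1) (ray_prefix k.+1 f) by exists f.
  rewrite -subst_pow_pivot /= subst_pow_pivot => -[_ [g _ <-] fg].
  exists (nseq (L * l ^ k) (digit ord0) ++ ray_prefix k g); first by exists g.
  by rewrite E; exists (ray_prefix k.+1 f).
Qed.

Lemma seed_wordE k f : nseq (L * l ^ k) (digit ord0) ++ ray_prefix k f =
  mkseq (fun t => ray f (t%:Z - (L * l ^ k)%:Z)) (l ^ k.+1).
Proof.
rewrite ray_prefixE /mkseq expnS mulSn addnC iotaD map_cat; congr cat.
  apply: (@eq_from_nth _ pivot); first by rewrite size_nseq size_map size_iota.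
  move=> i; rewrite size_nseq => lti.
  rewrite nth_nseq lti (nth_map 0%N) ?size_iota // nth_iota // add0n.
  have : i%:Z - (L * l ^ k)%:Z < 0 by rewrite subr_lt0 ltz_nat.
  by rewrite /ray; case: (i%:Z - _).
rewrite add0n -[in RHS](addn0 (L * _)%N) [in RHS]iotaDl -map_comp.
by apply: eq_map => t /=; congr ray; lia.
Qed.

(** * Legal words as windows of rays *)

Lemma subst_pow_ray k a v : subst_pow theta k.+1 a v ->
  exists f (o : int), v = mkseq (fun t => ray f (t%:Z + o)) (size v).
Proof.
case: a => [[i|]|].
(* A constant word is a window of a ray with constant [f]; the offset 1 starts it just after the
   pivot. *)
- rewrite [X in X v](subst_pow_digit k.+1 i) => ->; exists (fun=> i), 1.
  apply: (@eq_from_nth _ pivot); first by rewrite size_mkseq.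
  move=> t; rewrite size_nseq => ltt; rewrite nth_nseq ltt nth_mkseq ?size_nseq //.
  by rewrite -PoszD addn1.
- rewrite [X in X v](subst_pow_pivot k.+1) => -[f _ <-]; exists f, 0.
  rewrite ray_prefixE size_mkseq; apply: eq_mkseq => t.
  by rewrite addr0.
- rewrite [X in X v](subst_pow_seed k) => -[f _ <-].
  exists f, (- (L * l ^ k)%:Z).
  by rewrite seed_wordE size_mkseq.
Qed.

Lemma factorE f i n :
  Defs.factor (ray f) i n = mkseq (fun t => ray f (i + t%:Z)) n :> seq letter.
Proof.
apply: (@eq_from_nth _ pivot); first by rewrite size_tuple size_mkseq.
move=> t; rewrite size_tuple => ltt; rewrite nth_mkseq //.
by rewrite -[t]/(nat_of_ord (Ordinal ltt)) -tnth_nth tnth_mktuple.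
Qed.

Lemma legal_ray n (u : n.-tuple letter) : legal theta u ->
  exists f j, u = Defs.factor (ray f) j n.
Proof.
move=> [[|k] [a [v []]]] // _ /subst_pow_ray [f [d vE]] /infixP [p [s vpus]].
exists f, ((size p)%:Z + d); apply: val_inj; rewrite /= factorE.
apply: (@eq_from_nth _ pivot); first by rewrite size_tuple size_mkseq.
move=> t; rewrite size_tuple => ltt; rewrite nth_mkseq //.
have ltv : (size p + t < size v)%N.
  by rewrite vpus !size_cat size_tuple ltn_add2l ltn_addr.
transitivity (nth pivot v (size p + t)).
  by rewrite vpus nth_cat ltnNge leq_addr addKn nth_cat size_tuple ltt.
by rewrite vE nth_mkseq //; congr (ray f _); rewrite PoszD addrAC.
Qed.

Lemma ray_subshift f : subshift theta (ray f).
Proof.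
move=> i n /=.
(* [k] bounds the reach of the window on either side of the pivot, and both arms of the seed word,
   of lengths [L * l ^ k] and [l ^ k], are longer than [k]. *)
pose k := (`|i| + n)%N.
have lk : (k < l ^ k)%N by apply: ltn_expl.
exists k.+1, seed, (nseq (L * l ^ k) (digit ord0) ++ ray_prefix k f); split=> //.
  by rewrite subst_pow_seed; exists f.
have ltLk : (k < L * l ^ k)%N by apply: leq_trans lk _; apply: leq_pmull.
rewrite seed_wordE factorE.
have -> : mkseq (fun t => ray f (i + t%:Z)) n =
  mkseq (fun t => (fun t => ray f (t%:Z - (L * l ^ k)%:Z))
     (`|(i + (L * l ^ k)%:Z)%R| + t))%N n.
  by apply: eq_mkseq => t /=; congr ray; rewrite /k in ltLk *; lia.
by apply: infix_mkseq; rewrite expnS mulSn; rewrite /k in ltLk lk *; lia.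
Qed.

(** * Counting windows *)

Lemma ray_eq_on f g (N : nat) (t : int) :
  (forall k, (k <= trunc_log l N)%N -> f k = g k) -> t <= N%:Z ->
  ray f t = ray g t.
Proof.
case: t => [[|t]|t] // fg tN; rewrite /ray fg //.
by apply: leq_trunc_log; rewrite -lez_nat.
Qed.

Lemma ray_pivot f t : ray f t = pivot -> t = 0.
Proof. by case: t => [[|t]|t]. Qed.

Lemma ray_expn f k : ray f (l ^ k)%N%:Z = digit (f k).
Proof.
rewrite /ray -(prednK (n := l ^ k)) ?expn_gt0 // prednK ?expn_gt0 //.
by rewrite trunc_expnK.
Qed.

(* Windows starting to the left of position n see few levels of f; windows
   starting further right see at most two consecutive blocks, as l >= 2. *)
Lemma complexity_le n : (0 < n)%N ->
  (complexity (subshift theta) n <=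
   n.*2 * m.+1 ^ (trunc_log l n.*2).+1 + n.+1 * m.+1 ^ 2)%N.
Proof.
move=> n_gt0; set K := trunc_log l n.*2.
(* Starts range over -n <= j < n; such a window ends before 2n and sees no level above [K]. *)
pose near (x : 'I_n.*2 * {ffun 'I_K.+1 -> 'I_m.+1}) : n.-tuple letter :=
  Defs.factor (ray (fun k => x.2 (inord k))) ((x.1 : nat)%:Z - n%:Z) n.
pose far (x : 'I_n.+1 * ('I_m.+1 * 'I_m.+1)) : n.-tuple letter :=
  [tuple digit (if (t < x.1)%N then x.2.1 else x.2.2) | t < n].
have card_near : (#|[set near x | x in predT]%SET| <= n.*2 * m.+1 ^ K.+1)%N.
  apply: leq_trans (leq_imset_card _ _) _.
  by rewrite card_prod card_ffun !card_ord.
have card_far : (#|[set far x | x in predT]%SET| <= n.+1 * m.+1 ^ 2)%N.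
  by apply: leq_trans (leq_imset_card _ _) _; rewrite !card_prod !card_ord.
apply: leq_trans (leq_add card_near card_far).
apply: leq_trans (leq_card_setU _ _); apply: subset_leq_card.
apply/fintype.subsetP => u; rewrite [X in X -> _]inE => -[w Xw [i0 uw]].
have [f [j ->]] : exists f j, u = Defs.factor (ray f) j n.
  by apply: legal_ray; rewrite uw; exact: Xw.
rewrite inE; apply/orP.
have [jlt|jge] := ltP j n%:Z.
  left; apply/imsetP.
  (* A window starting left of -n shows only the digit [ord0], as does the one starting at -n, so
     the start may be clamped. *)
  pose j0 : int := if (j < - n%:Z)%R then - n%:Z else j.
  have near_lt : (`|(j0 + n%:Z)%R|%N < n.*2)%N by rewrite /j0; case: ifP => jn; lia.
  exists (Ordinal near_lt, [ffun k : 'I_K.+1 => f k]) => //.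
  apply: eq_from_tnth => t; rewrite !tnth_mktuple /=.
  have ltt := ltn_ord t.
  have -> : `|(j0 + n%:Z)%R|%N%:Z - n%:Z = j0 by rewrite /j0; case: ifP => jn; lia.
  rewrite /j0; case: ifP => jn.
    set t1 := j + _; set t2 := - _ + _.
    have : t1 < 0 by rewrite /t1; lia.
    have : t2 < 0 by rewrite /t2; lia.
    by case: t1 t2 => [?|?] [?|?].
  apply: (@ray_eq_on _ _ n.*2); last by lia.
  by move=> k lek; rewrite ffunE inordK.
right; apply/imsetP.
have jE : j = `|j|%N%:Z by lia.
set p := `|j|%N in jE; have np : (n <= p)%N by lia.
pose k := trunc_log l p.
have [lep ltp] : (l ^ k <= p)%N /\ (p < l ^ k.+1)%N.
  by split; [apply: trunc_logP|apply: trunc_log_ltn] => //; lia.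
have far_lt : (minn n (l ^ k.+1 - p) < n.+1)%N by rewrite ltnS geq_minl.
exists (Ordinal far_lt, (f k, f k.+1)) => //.
apply: eq_from_tnth => t; rewrite !tnth_mktuple /=.
have ltt := ltn_ord t.
have -> : j + (t : nat)%:Z = (p + t).-1.+1%:Z by lia.
rewrite /ray prednK; last by lia.
(* Since p + n <= 2p < 2 l^(k+1) <= l^(k+2), only the levels [k] and [k.+1] occur. *)
have pow2 : (2 * l ^ k.+1 <= l ^ k.+2)%N by rewrite [(l ^ k.+2)%N]expnS leq_pmul2r ?expn_gt0.
have -> : (t < minn n (l ^ k.+1 - p))%N = (p + t < l ^ k.+1)%N by lia.
congr digit; case: ifP => ptk; congr f; apply: trunc_log_eq => //; lia.
Qed.

(** Start fewer than [uphalf n] positions left of the pivot. The visible pivot betrays the shift,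
    and the window still reaches position [l ^ k] for each [k < K], where [f k] can be read off. *)
Lemma complexity_ge n :
  (uphalf n * m.+1 ^ trunc_log l n./2 <= complexity (subshift theta) n)%N.
Proof.
set K := trunc_log l n./2.
(* Levels from [K] on are frozen at [ord0]; only those below [K] are counted. *)
pose level (f : {ffun 'I_K -> 'I_m.+1}) (k : nat) : 'I_m.+1 :=
  if insub k is Some j then f j else ord0.
pose word (x : 'I_(uphalf n) * {ffun 'I_K -> 'I_m.+1}) : n.-tuple letter :=
  Defs.factor (ray (level x.2)) (- (x.1 : nat)%:Z) n.
have word_inj : injective word.
  move=> [s f] [s' f'] E.
  have half := uphalf_half n; have odd_half := odd_double_half n.
  have tn i : (i < n)%N ->
      ray (level f) (- (s : nat)%:Z + i%:Z) =
      ray (level f') (- (s' : nat)%:Z + i%:Z).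
    move=> lti; have := congr1 (fun u => tnth u (Ordinal lti)) E.
    by rewrite !tnth_mktuple.
  have lts := ltn_ord s; have lts' := ltn_ord s'.
  have ss' : s = s'.
    apply: val_inj; have /tn : (s < n)%N by lia.
    rewrite addNr => /esym /ray_pivot /=; lia.
  rewrite -ss' in tn *; congr pair; apply/ffunP => k.
  have ltk := ltn_ord k.
  have half_gt0 : (0 < n./2)%N.
    case: posnP => // h0; have : (0 < K)%N by apply: leq_ltn_trans ltk.
    by rewrite /K h0 trunc_log0.
  have le_lk : (l ^ k < n./2)%N.
    apply: (@leq_trans (l ^ K)); first by rewrite ltn_exp2l.
    exact: trunc_logP.
  have /tn : (s + l ^ k < n)%N by lia.
  rewrite PoszD addKr !ray_expn /level !valK.
  by case.
have <- : #|[set word x | x in predT]%SET| = (uphalf n * m.+1 ^ K)%N.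
  by rewrite card_imset // card_prod card_ffun !card_ord.
apply: subset_leq_card; apply/fintype.subsetP => _ /imsetP [x _ ->].
rewrite inE; exists (ray (level x.2)); first exact: ray_subshift.
by exists (- (x.1 : nat)%:Z).
Qed.

End Construction.

(** * From the counts to the growth rate *)

(** With x = l and y = M, this turns the number M^k of digit choices into (l^k)^b, which is
    comparable with n^b. *)
Lemma natr_expn_powR {R : realType} {x y : nat} {b : R} (k : nat) :
  x%:R `^ b = y%:R -> (y ^ k)%:R = (x ^ k)%:R `^ b.
Proof.
move=> xy; rewrite !natrX -xy -!powR_mulrn ?powR_ge0 ?ler0n //.
exact: powRAC.
Qed.

Lemma complexity_theta (R : realType) (L m : nat) (b : R) :
  (0 < L)%N -> 0 <= b -> L.+1%:R `^ b = m.+1%:R ->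
  isTheta (fun n : nat => n%:R `^ (1 + b))
    (fun n : nat => (complexity (subshift (theta L m)) n)%:R).
Proof.
move=> L_gt0 b_ge0 lM.
have l_gt1 : (1 < L.+1)%N by [].
set l := L.+1 in lM l_gt1.
(* [D] pays for the factor 2 between n and the argument 2n or n/2 of the logarithm. *)
pose M : R := m.+1%:R; pose D : R := 2 `^ b.
have M_gt0 : 0 < M by rewrite ltr0n.
have D_gt0 : 0 < D by exact: powR_gt0.
set p := fun n => (complexity _ n)%:R.
have mono (x y : R) : 0 <= x -> x <= y -> x `^ b <= y `^ b.
  by move=> x0 xy; apply: ge0_ler_powR; rewrite ?nnegrE // (le_trans x0).
have fE n : (0 < n)%N -> n%:R `^ (1 + b) = n%:R * n%:R `^ b :> R.
  move=> n_gt0; rewrite powRD ?powRr1 ?ler0n //.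
  by rewrite pnatr_eq0 -lt0n n_gt0 implybT.
have p_le n : (0 < n)%N -> p n <= (2 * M * D + 2 * M ^+ 2) * n%:R `^ (1 + b).
  move=> n_gt0; rewrite fE //.
  have n_ge1 : 1 <= n%:R :> R by rewrite ler1n.
  have nb_ge1 : 1 <= n%:R `^ b by have := mono 1 n%:R; rewrite powR1; apply.
  have Xle : (m.+1 ^ trunc_log l n.*2)%:R <= D * n%:R `^ b.
    rewrite (natr_expn_powR _ lM) -powRM ?ler0n //; apply: mono => //.
    by rewrite -natrM mul2n ler_nat trunc_logP // double_gt0.
  have := complexity_le _ m L_gt0 _ n_gt0.
  rewrite -/l [(m.+1 ^ _.+1)%N]expnS; move: (_ ^ _)%N Xle => X Xle.
  rewrite -(ler_nat R) -/(p n).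
  have -> : (n.*2 * (m.+1 * X) + n.+1 * m.+1 ^ 2)%:R =
      2 * n%:R * (M * X%:R) + (n%:R + 1) * M ^+ 2 :> R.
    by rewrite /M -mul2n; ring.
  move=> pn.
  apply: le_trans pn _.
  have : n%:R * M * X%:R <= n%:R * M * (D * n%:R `^ b).
    by apply: ler_wpM2l => //; rewrite mulr_ge0 // ltW.
  (* The far windows are only linear in number: n + 1 <= 2n, and n^b >= 1. *)
  have : (n%:R + 1) * M ^+ 2 <= (2 * n%:R * n%:R `^ b) * M ^+ 2.
    rewrite ler_wpM2r ?sqr_ge0 //; nra.
  lra.
have p_ge n : (0 < n)%N -> n%:R `^ (1 + b) <= p n * (2 * M * D).
  move=> n_gt0; rewrite fE //.
  have n_ge1 : 1 <= n%:R :> R by rewrite ler1n.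
  have nE : n%:R = 2 * (n%:R / 2) :> R by field.
  have nb : n%:R `^ b = D * (n%:R / 2) `^ b.
    by rewrite [in LHS]nE powRM // divr_ge0.
  set X : R := (m.+1 ^ trunc_log l n./2)%:R.
  (* The power of [l] after the last one below [n./2] is at least n/2; this extra factor [l] costs a
     factor [M]. *)
  have : (n%:R / 2) `^ b <= M * X.
    rewrite /M /X -natrM -expnS (natr_expn_powR _ lM); apply: mono.
      by rewrite divr_ge0.
    rewrite ler_pdivrMr // -natrM ler_nat.
    have := trunc_log_ltn n./2 l_gt1.
    by have := odd_double_half n; lia.
  have : n%:R <= 2 * (uphalf n)%:R :> R.
    rewrite -natrM ler_nat; have := uphalf_half n.
    by have := odd_double_half n; lia.
  have := complexity_ge _ m L_gt0 n.
  rewrite -(ler_nat R) natrM -/(p n) -/l -/X => pn hn hX.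
  rewrite nb.
  have X_ge0 : 0 <= X by rewrite ler0n.
  apply: (@le_trans _ _ ((2 * (uphalf n)%:R) * (D * (M * X)))).
    apply: ler_pM => //; first by rewrite mulr_ge0 ?powR_ge0 ?ltW.
    by apply: ler_wpM2l => //; exact: ltW.
  have -> : 2 * (uphalf n)%:R * (D * (M * X)) =
     (uphalf n)%:R * X * (2 * M * D) :> R by ring.
  by rewrite ler_wpM2r // !mulr_ge0 // ltW.
have f_gt0 n : (0 < n)%N -> 0 < n%:R `^ (1 + b) :> R.
  by move=> n_gt0; rewrite powR_gt0 // ltr0n.
have C1_gt0 : 0 < 2 * M * D by rewrite !mulr_gt0.
have C2_gt0 : 0 < 2 * M * D + 2 * M ^+ 2.
  by apply: addr_gt0 => //; rewrite mulr_gt0 // exprn_gt0.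
have p_gt0 n : (0 < n)%N -> 0 < p n.
  move=> n_gt0; rewrite -(pmulr_lgt0 _ C1_gt0).
  exact: lt_le_trans (f_gt0 _ n_gt0) (p_ge _ n_gt0).
split=> [n n_gt0|]; first by split; [exact: f_gt0|exact: p_gt0].
(* Adding 1 makes both inequalities strict. *)
exists (2 * M * D + 2 * M ^+ 2 + 1)^-1, (2 * M * D + 1).
split; [by rewrite invr_gt0 addr_gt0|by rewrite addr_gt0|move=> n n_gt0].
have C_gt0 : 0 < 2 * M * D + 2 * M ^+ 2 + 1 by exact: addr_gt0.
have pn_gt0 := p_gt0 n n_gt0; have fn_gt0 := f_gt0 n n_gt0.
have le1 := p_le n n_gt0; have le2 := p_ge n n_gt0.
rewrite -/(p n) ltr_pdivrMr // ltr_pdivlMr // ltr_pdivrMl //.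
by apply/andP; split; lra.
Qed.

(** * Density of the exponents *)

Theorem proposition5p1 (R : realType) :
  dense_in `[(1 : R), +oo[
    [set alpha : R | exists (A : finType) (theta : random_substitution A),
       constant_length theta /\
       isTheta (fun n : nat => n%:R `^ alpha)
               (fun n : nat => (complexity (subshift theta) n)%:R)].
Proof.
move=> y; rewrite /= in_itv /= andbT => y_ge1 B /nbhs_ex [d dB].
(* As 1/q < d, rounding (y - 1) q down to p puts p/q less than d below y - 1. *)
pose q := (Num.trunc (d%:num^-1 : R)).+1.
have q_gt0 : 0 < q%:R :> R by rewrite ltr0n.
have dq : d%:num^-1 < q%:R by exact: truncnS_gt.
pose p := Num.trunc ((y - 1) * q%:R).
have yq_ge0 : 0 <= (y - 1) * q%:R by rewrite mulr_ge0 ?subr_ge0 // ltW.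
have /andP [ple plt] := truncn_itv yq_ge0.
rewrite -/p in ple plt.
pose b : R := p%:R / q%:R.
have b_ge0 : 0 <= b by rewrite divr_ge0.
exists (1 + b); split; last first.
  apply: dB; rewrite /ball /= ltr_norml.
  have dq1 : q%:R^-1 < d%:num by rewrite invf_plt ?posrE.
  have b_le : b <= y - 1 by rewrite ler_pdivrMr.
  have b_gt : y - 1 < b + q%:R^-1.
    have -> : b + q%:R^-1 = (p%:R + 1) / q%:R by rewrite mulrDl mul1r.
    by rewrite natr1 ltr_pdivlMr.
  have := gt0 d; lra.
split; last by rewrite /= in_itv /= andbT lerDl.
(* Then l^b = 2^(q p/q) = 2^p = M exactly; p = 0 leaves a single digit and exponent 1. *)
pose L := (2 ^ q).-1; pose m := (2 ^ p).-1.
have LE : L.+1 = (2 ^ q)%N by rewrite prednK ?expn_gt0.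
have mE : m.+1 = (2 ^ p)%N by rewrite prednK ?expn_gt0.
have l_ge2 : (2 <= L.+1)%N by rewrite LE -{1}(expn1 2) leq_exp2l.
exists (letter m), (theta L m); split.
  by exists L.+1; split=> // a v; exact: rules_size.
apply: complexity_theta => //.
rewrite LE mE !natrX -!powR_mulrn // -powRrM.
by rewrite /b mulrCA divff ?mulr1 // gt_eqF.
Qed.
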